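(* Let $H$ be a Hopf algebra over a field $\Bbbk$. Let $A$ be a partial $H$-module algebra with system of local units $S=\{e_\lambda\}_{\lambda\in\Lambda}$ and with symmetrical $S$-categorizable partial action. Then the category of unital left $\underline{A\#H}$-modules is equivalent to the category of $\underline{\mathcal{C}^S(A)\#H}$-modules.
   Context: Algebras are associative $\Bbbk$-algebras, not necessarily unital; $\Delta(h)=\sum h_{(1)}\otimes h_{(2)}$. A partial action of $H$ on $A$ is a linear map $\cdot:H\otimes A\to A$ with, for all $a,b\in A$, $h,k\in H$: $1_H\cdot a=a$ and $h\cdot(a(k\cdot b))=\sum(h_{(1)}\cdot a)(h_{(2)}k\cdot b)$; $A$ is then a partial $H$-module algebra. It is symmetrical if also $h\cdot((k\cdot b)a)=\sum(h_{(1)}k\cdot b)(h_{(2)}\cdot a)$. A system of local units of $A$ is a set $S=\{e_\lambda\}_{\lambda\in\Lambda}$ of idempotents such that for every finite $F\subseteq A$ there is $e_\alpha\in S$ with $e_\alpha a=ae_\alpha=a$ for all $a\in F$. The partial action is $S$-categorizable if $H\cdot e_\alpha\subseteq e_\alpha Ae_\alpha$ for every $e_\alpha\in S$; in that case $H\cdot(e_\beta Ae_\alpha)\subseteq e_\beta Ae_\alpha$ for all $\alpha,\beta\in\Lambda$. The partial smash product $\underline{A\#H}$ is the subalgebra $(A\#H)(A\#1_H)$, spanned by the elements $\sum a(h_{(1)}\cdot b)\#h_{(2)}$, of $A\#H$, which is $A\otimes H$ with product $(a\#h)(b\#k)=\sum a(h_{(1)}\cdot b)\#h_{(2)}k$.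 A left $R$-module $M$ is unital if $RM=M$. $\mathcal{C}^S(A)$ is the $\Bbbk$-category with object set $\Lambda$, morphisms from $\alpha$ to $\beta$ given by $e_\beta Ae_\alpha$, and composition the multiplication of $A$; $H$ acts partially on it by restricting $\cdot$ to each $e_\beta Ae_\alpha$. The $\Bbbk$-category $\underline{\mathcal{C}^S(A)\#H}$ has object set $\Lambda$; its space of morphisms from $\alpha$ to $\beta$ is the subspace of $e_\beta Ae_\alpha\otimes H$ spanned by the elements $\sum f(h_{(1)}\cdot e_\alpha)\otimes h_{(2)}$ with $f\in e_\beta Ae_\alpha$, $h\in H$; composition is $(g\otimes h)\circ(f\otimes k)=\sum g(h_{(1)}\cdot f)\otimes h_{(2)}k$; the identity of $\alpha$ is $e_\alpha\otimes1_H$. A module over a $\Bbbk$-category is a $\Bbbk$-linear functor from it to $\Bbbk$-vector spaces, with natural transformations as morphisms. *)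

(* Defs.v *)
From HB Require Import structures.
From mathcomp Require Import all_boot all_algebra.
From mathcomp Require Import boolp classical_sets.

Set Implicit Arguments.
Unset Strict Implicit.
Unset Printing Implicit Defensive.

Import GRing.Theory.
Local Open Scope ring_scope.
Local Open Scope classical_set_scope.
Local Open Scope quotient_scope.

Notation bilinear f := (bilinear_for *:%R *:%R f).

Section LinearMaps.
Variable k : fieldType.
Implicit Types U V W X : lmodType k.

Definition mk_linear U V (f : U -> V) (fL : linear f) : {linear U -> V} :=
  HB.pack f (GRing.isLinear.Build k U V *:%R f fL).

Lemma lin_sum U V (f : U -> V) (fL : linear f) I (r : seq I) (F : I -> U) :
  f (\sum_(i <- r) F i) = \sum_(i <- r) f (F i).
Proof. exact: (linear_sum (mk_linear fL)). Qed.

Lemma lin0 U V (f : U -> V) (fL : linear f) : f 0 = 0.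
Proof. exact: (linear0 (mk_linear fL)). Qed.

Lemma linD U V (f : U -> V) (fL : linear f) : {morph f : u v / u + v}.
Proof. exact: (linearD (mk_linear fL)). Qed.

Lemma linZ U V (f : U -> V) (fL : linear f) a : {morph f : u / a *: u}.
Proof. exact: (linearZZ (mk_linear fL)). Qed.

Lemma lin_id U : linear (fun x : U => x). Proof. by []. Qed.

Lemma lin_comp U V W (g : V -> W) (f : U -> V) :
  linear g -> linear f -> linear (fun x => g (f x)).
Proof. by move=> gL fL a u v; rewrite fL gL. Qed.

Lemma bilin_l U V W X (f : U -> V -> W) (g : X -> U) v :
  bilinear f -> linear g -> linear (fun x => f (g x) v).
Proof. by move=> fB gL a x y; rewrite gL; apply: (fB.1 v). Qed.

Lemma bilin_r U V W X (f : U -> V -> W) (g : X -> V) u :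
  bilinear f -> linear g -> linear (fun x => f u (g x)).
Proof. by move=> fB gL a x y; rewrite gL; apply: (fB.2 u). Qed.

End LinearMaps.

(* V (x) W is the set of formal finite sums of pairs (v, w), two sums being
   identified when every bilinear map to a vector space takes the same value on
   them; the universal property is given by tensB, tliftE, tlift_lin, tensP. *)
Section Tensor.
Variables (k : fieldType) (V W : lmodType k).

Definition fsum (X : lmodType k) (f : V -> W -> X) (s : seq (V * W)) : X :=
  \sum_(p <- s) f p.1 p.2.

Definition tens_rel (s t : seq (V * W)) : Prop :=
  forall (X : lmodType k) (f : V -> W -> X), bilinear f -> fsum f s = fsum f t.

Definition tens_relb : rel (seq (V * W)) := fun s t => `[< tens_rel s t >].

Lemma tens_relb_refl : reflexive tens_relb.
Proof. by move=> s; apply/asboolP. Qed.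

Lemma tens_relb_sym : symmetric tens_relb.
Proof.
by move=> s t; apply/asboolP/asboolP => st X f fB; rewrite (st X f fB).
Qed.

Lemma tens_relb_trans : transitive tens_relb.
Proof.
move=> t s u /asboolP st /asboolP tu; apply/asboolP => X f fB.
by rewrite (st X f fB) (tu X f fB).
Qed.

Definition tens_equiv : equiv_rel (seq (V * W)) :=
  EquivRel tens_relb tens_relb_refl tens_relb_sym tens_relb_trans.

Definition tensor : Type := {eq_quot tens_equiv}.
HB.instance Definition _ := Choice.on tensor.
HB.instance Definition _ := EqQuotient.on tensor.

Definition formal (s : seq (V * W)) : tensor := \pi_tensor s.

Lemma formalP s t : tens_rel s t -> formal s = formal t.
Proof. by move=> st; apply/eqmodP/asboolP. Qed.

(* The linear map on the tensor product induced by f; meaningful when f is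
   bilinear, as in every use below. *)
Definition tlift (X : lmodType k) (f : V -> W -> X) (t : tensor) : X :=
  fsum f (repr t).

Lemma tlift_formal (X : lmodType k) (f : V -> W -> X) s :
  bilinear f -> tlift f (formal s) = fsum f s.
Proof.
move=> fB; rewrite /tlift.
have /eqmodP/asboolP: repr (formal s) = s %[mod tensor] by rewrite reprK.
exact.
Qed.

Lemma tensor_eq (s t : tensor) :
  (forall (X : lmodType k) (f : V -> W -> X), bilinear f ->
     tlift f s = tlift f t) -> s = t.
Proof.
by move=> st; rewrite -[s]reprK -[t]reprK; apply/formalP => X f; apply: st.
Qed.

Definition tens_add (s t : tensor) : tensor := formal (repr s ++ repr t).
Definition tens_scale (a : k) (t : tensor) : tensor :=
  formal [seq (a *: p.1, p.2) | p <- repr t].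

Lemma fsum_scale (X : lmodType k) (f : V -> W -> X) a s : bilinear f ->
  fsum f [seq (a *: p.1, p.2) | p <- s] = a *: fsum f s.
Proof.
move=> fB; rewrite /fsum big_map scaler_sumr; apply: eq_bigr => p _ /=.
exact: (linZ (fB.1 p.2)).
Qed.

Lemma tlift_add (X : lmodType k) (f : V -> W -> X) s t : bilinear f ->
  tlift f (tens_add s t) = tlift f s + tlift f t.
Proof. by move=> fB; rewrite tlift_formal // /fsum big_cat. Qed.

Lemma tlift_scale (X : lmodType k) (f : V -> W -> X) a s : bilinear f ->
  tlift f (tens_scale a s) = a *: tlift f s.
Proof. by move=> fB; rewrite tlift_formal // fsum_scale. Qed.

Lemma tlift_nil (X : lmodType k) (f : V -> W -> X) : bilinear f ->
  tlift f (formal [::]) = 0.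
Proof. by move=> fB; rewrite tlift_formal // /fsum big_nil. Qed.

Lemma tens_addA : associative tens_add.
Proof. by move=> s t u; apply: tensor_eq => X f fB; rewrite !tlift_add // addrA. Qed.

Lemma tens_addC : commutative tens_add.
Proof. by move=> s t; apply: tensor_eq => X f fB; rewrite !tlift_add // addrC. Qed.

Lemma tens_add0 : left_id (formal [::]) tens_add.
Proof.
by move=> t; apply: tensor_eq => X f fB; rewrite tlift_add // tlift_nil // add0r.
Qed.

Lemma tens_addN : left_inverse (formal [::]) (tens_scale (-1)) tens_add.
Proof.
move=> t; apply: tensor_eq => X f fB.
by rewrite tlift_add // tlift_scale // tlift_nil // scaleN1r addNr.
Qed.

HB.instance Definition _ :=
  GRing.isZmodule.Build tensor tens_addA tens_addC tens_add0 tens_addN.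

Lemma tens_scaleA a b t : tens_scale a (tens_scale b t) = tens_scale (a * b) t.
Proof. by apply: tensor_eq => X f fB; rewrite !tlift_scale // scalerA. Qed.

Lemma tens_scale1 : left_id 1 tens_scale.
Proof. by move=> t; apply: tensor_eq => X f fB; rewrite tlift_scale // scale1r. Qed.

Lemma tens_scaleDr : right_distributive tens_scale +%R.
Proof.
move=> a s t; apply: tensor_eq => X f fB.
by rewrite tlift_scale // !tlift_add // !tlift_scale // scalerDr.
Qed.

Lemma tens_scaleDl t : {morph tens_scale^~ t : a b / a + b}.
Proof.
move=> a b; apply: tensor_eq => X f fB.
by rewrite tlift_add // !tlift_scale // scalerDl.
Qed.

HB.instance Definition _ := GRing.Zmodule_isLmodule.Build k tensor
  tens_scaleA tens_scale1 tens_scaleDr tens_scaleDl.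

Definition tens (v : V) (w : W) : tensor := formal [:: (v, w)].

Lemma tlift_lin (X : lmodType k) (f : V -> W -> X) : bilinear f -> linear (tlift f).
Proof. by move=> fB a s t; rewrite tlift_add // tlift_scale. Qed.

Lemma tliftE (X : lmodType k) (f : V -> W -> X) v w :
  bilinear f -> tlift f (tens v w) = f v w.
Proof. by move=> fB; rewrite tlift_formal // /fsum big_seq1. Qed.

Lemma tensB : bilinear tens.
Proof.
split=> [w|v] a x y; apply: tensor_eq => X f fB;
  rewrite (tlift_lin fB) !tliftE //; [exact: (fB.1 w)|exact: (fB.2 v)].
Qed.

Lemma tens_sum (t : tensor) : t = tlift tens t.
Proof.
apply: tensor_eq => X f fB.
rewrite [tlift tens t]/tlift /fsum (lin_sum (tlift_lin fB)).
by apply: eq_bigr => p _; rewrite tliftE.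
Qed.

Lemma tensP (X : lmodType k) (f g : tensor -> X) : linear f -> linear g ->
  (forall v w, f (tens v w) = g (tens v w)) -> f =1 g.
Proof.
move=> fL gL fg t; rewrite (tens_sum t) /tlift /fsum (lin_sum fL) (lin_sum gL).
by apply: eq_bigr => p _.
Qed.

End Tensor.

Arguments tlift {k V W X} f t.
Arguments tens {k V W} v w.
Notation "V *t W" := (tensor V W) (at level 40, left associativity) : type_scope.
Infix "*t" := tens : ring_scope.

Section TliftTheory.
Variables (k : fieldType).
Implicit Types U V W X Y : lmodType k.

Lemma eq_tlift V W X (f g : V -> W -> X) t :
  (forall v w, f v w = g v w) -> tlift f t = tlift g t.
Proof. by move=> fg; apply: eq_bigr => p _. Qed.

Lemma tlift_comp V W X Y (g : X -> Y) (f : V -> W -> X) t : linear g ->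
  g (tlift f t) = tlift (fun v w => g (f v w)) t.
Proof. by move=> gL; rewrite /tlift /fsum (lin_sum gL). Qed.

Lemma lin_tlift U V W X (F : U -> V -> W -> X) t :
  (forall v w, linear (fun x => F x v w)) -> linear (fun x => tlift (F x) t).
Proof.
move=> FL a x y; rewrite /tlift /fsum scaler_sumr -big_split.
by apply: eq_bigr => p _; apply: FL.
Qed.

Lemma tlift_exchange V W V' W' X (F : V -> W -> V' -> W' -> X) t t' :
  tlift (fun v w => tlift (F v w) t') t =
  tlift (fun v' w' => tlift (fun v w => F v w v' w') t) t'.
Proof. exact: exchange_big. Qed.

End TliftTheory.

Section Subspaces.
Variables (k : fieldType) (V : lmodType k).

Record subspace := Subspace {
  subspace_set :> V -> Prop;
  subspace0 : subspace_set 0;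
  subspaceP : forall a u v, subspace_set u -> subspace_set v ->
                subspace_set (a *: u + v) }.

Variable U : subspace.

Definition subspace_mem : {pred V} := fun x => `[< U x >].

Lemma subspace_mem_closed : submod_closed subspace_mem.
Proof.
split=> [|a u v /asboolP Uu /asboolP Uv]; apply/asboolP.
  exact: subspace0.
exact: subspaceP.
Qed.

HB.instance Definition _ := GRing.isSubmodClosed.Build k V subspace_mem
  (GRing.submod_closed_semi subspace_mem_closed).

Definition subsp : Type := {x : V | x \in subspace_mem}.
HB.instance Definition _ := [isSub of subsp for @proj1_sig V _].
HB.instance Definition _ := [Choice of subsp by <:].
HB.instance Definition _ := [SubChoice_isSubZmodule of subsp by <:].
HB.instance Definition _ := [SubZmodule_isSubLmodule of subsp by <:].

Definition mk_subsp (x : V) (Ux : U x) : subsp := Sub x (asboolT Ux).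

Lemma subspP (x : subsp) : U (val x).
Proof. exact/asboolP/(valP x). Qed.

End Subspaces.

Section Span.
Variables (k : fieldType) (V : lmodType k) (P : set V).

Definition lspan_set : set V := fun x => forall U : subspace V, P `<=` U -> U x.

Lemma lspan_set0 : lspan_set 0. Proof. by move=> U _; exact: subspace0. Qed.

Lemma lspan_setP a u v : lspan_set u -> lspan_set v -> lspan_set (a *: u + v).
Proof. by move=> Pu Pv U PU; apply: subspaceP; [exact: Pu|exact: Pv]. Qed.

Definition lspan : subspace V := Subspace lspan_set0 lspan_setP.

Lemma sub_lspan : P `<=` lspan. Proof. by move=> x Px U; apply. Qed.

End Span.

Section SubspaceTheory.
Variables (k : fieldType) (V W : lmodType k).

Lemma subspace_sum (X : lmodType k) (U : subspace X) I (r : seq I) (F : I -> X) :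
  (forall i, U (F i)) -> U (\sum_(i <- r) F i).
Proof.
move=> UF; elim/big_ind: _ => //; first exact: subspace0.
by move=> x y Ux Uy; rewrite -[x]scale1r; apply: subspaceP.
Qed.

Lemma subspace_tlift (X : lmodType k) (U : subspace X) (F : V -> W -> X) t :
  (forall v w, U (F v w)) -> U (tlift F t).
Proof. by move=> UF; rewrite /tlift /fsum; apply: subspace_sum => p; apply: UF. Qed.

Lemma lspan_image (P : set V) (U : subspace W) (f : V -> W) : linear f ->
  (forall x, P x -> U (f x)) -> forall x, lspan P x -> U (f x).
Proof.
move=> fL fP.
have f0 : U (f 0) by rewrite (lin0 fL); exact: subspace0.
have fC a u v : U (f u) -> U (f v) -> U (f (a *: u + v)).
  by rewrite fL; apply: subspaceP.
by move=> x; move/(_ (Subspace f0 fC)); apply.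
Qed.

Lemma lspan_ext (P : set V) (f g : V -> W) : linear f -> linear g ->
  (forall x, P x -> f x = g x) -> forall x, lspan P x -> f x = g x.
Proof.
move=> fL gL fg.
have S0 : f 0 = g 0 by rewrite (lin0 fL) (lin0 gL).
have SC a u v : f u = g u -> f v = g v -> f (a *: u + v) = g (a *: u + v).
  by move=> fu fv; rewrite fL gL fu fv.
by move=> x; move/(_ (Subspace (subspace_set := fun x => f x = g x) S0 SC)); apply.
Qed.

End SubspaceTheory.

(* In comulA both sides are taken in H (x) (H (x) H). The k-vector space H is
   arbitrary, and the antipode is not assumed bijective. *)
Record hopfAlgebra (k : fieldType) := HopfAlgebra {
  hopf_alg :> algType k;
  comul : hopf_alg -> hopf_alg *t hopf_alg;
  counit : hopf_alg -> k;
  antipode : hopf_alg -> hopf_alg;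
  comul_linear : linear comul;
  counit_linear : scalar counit;
  antipode_linear : linear antipode;
  comulA : forall h,
    tlift (fun h1 h2 => tlift (fun h11 h12 => h11 *t (h12 *t h2)) (comul h1))
      (comul h) =
    tlift (fun h1 h2 => h1 *t comul h2) (comul h);
  counit_l : forall h, tlift (fun h1 h2 => counit h1 *: h2) (comul h) = h;
  counit_r : forall h, tlift (fun h1 h2 => counit h2 *: h1) (comul h) = h;
  comul1 : comul 1 = 1 *t 1;
  comulM : forall h l, comul (h * l) =
    tlift (fun h1 h2 =>
      tlift (fun l1 l2 => (h1 * l1) *t (h2 * l2)) (comul l)) (comul h);
  counit1 : counit 1 = 1;
  counitM : {morph counit : h l / h * l};
  antipode_l : forall h,
    tlift (fun h1 h2 => antipode h1 * h2) (comul h) = counit h *: 1;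
  antipode_r : forall h,
    tlift (fun h1 h2 => h1 * antipode h2) (comul h) = counit h *: 1 }.

(* Sweedler notation: the sum over Delta(h) of F h_(1) h_(2). *)
Notation "'\sw_' ( x , y <- h ) F" := (tlift (fun x y => F) (comul h))
  (at level 41, x name, y name, h at level 41, F at level 41,
   format "\sw_ ( x ,  y  <-  h )  F") : ring_scope.

Section Sweedler.
Variables (k : fieldType) (H : hopfAlgebra k).

Lemma mulB (R : algType k) : bilinear (fun x y : R => x * y).
Proof.
split=> [y|x] a u v; first by rewrite mulrDl -scalerAl.
by rewrite mulrDr -scalerAr.
Qed.

Lemma sw_linear (X : lmodType k) (F : H -> H -> X) : bilinear F ->
  linear (fun h : H => \sw_(h1, h2 <- h) F h1 h2).
Proof. by move=> FB; apply: lin_comp (tlift_lin FB) (@comul_linear _ H). Qed.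

Lemma sw1 (X : lmodType k) (F : H -> H -> X) : bilinear F ->
  \sw_(h1, h2 <- (1 : H)) F h1 h2 = F 1 1.
Proof. by move=> FB; rewrite comul1 tliftE. Qed.

Lemma swA (X : lmodType k) (F : H -> H -> H -> X) h :
  (forall z, bilinear (fun x y => F x y z)) ->
  (forall x y, linear (F x y)) ->
  \sw_(h1, h2 <- h) \sw_(p, q <- h1) F p q h2 =
  \sw_(h1, h2 <- h) \sw_(p, q <- h2) F h1 p q.
Proof.
move=> F12 F3.
pose G (x : H) (t : H *t H) := tlift (F x) t.
have FxB x : bilinear (F x).
  by split=> [z|y] a u v; [apply: ((F12 z).2 x)|apply: F3].
have GB : bilinear G.
  split=> [t|x]; last exact: tlift_lin.
  by apply: lin_tlift => y z a u v; apply: ((F12 z).1 y).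
have := congr1 (tlift G) (comulA h).
rewrite !(tlift_comp _ _ (tlift_lin GB)).
under eq_tlift => h1 h2.
  rewrite (tlift_comp _ _ (tlift_lin GB)).
  under eq_tlift => p q do rewrite tliftE // /G tliftE //.
  over.
move=> ->.
by apply: eq_tlift => h1 h2; rewrite tliftE.
Qed.

Lemma swM (X : lmodType k) (F : H -> H -> X) h l : bilinear F ->
  \sw_(p, q <- (h * l)) F p q =
  \sw_(h1, h2 <- h) \sw_(l1, l2 <- l) F (h1 * l1) (h2 * l2).
Proof.
move=> FB; rewrite comulM (tlift_comp _ _ (tlift_lin FB)).
apply: eq_tlift => h1 h2; rewrite (tlift_comp _ _ (tlift_lin FB)).
by apply: eq_tlift => l1 l2; rewrite tliftE.
Qed.

End Sweedler.

Section SmashProduct.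
Variables (k : fieldType) (H : hopfAlgebra k).

(* (u # h)(v # l) = sum m(u, h_(1).v) # h_(2)l, for any m; used both for the
   multiplication of A # H and for the composition of morphisms. *)
Definition smash_mul (U V W : lmodType k) (m : U -> V -> W) (act : H -> V -> V)
    (s : U *t H) (t : V *t H) : W *t H :=
  tlift (fun u h => tlift (fun v l =>
    \sw_(h1, h2 <- h) (m u (act h1 v) *t (h2 * l))) t) s.

Section Bilinearity.
Variables (U V W : lmodType k) (m : U -> V -> W) (act : H -> V -> V).
Hypotheses (mB : bilinear m) (actB : bilinear act).

Lemma smash_coreB_h u v l :
  bilinear (fun h1 h2 : H => m u (act h1 v) *t (h2 * l)).
Proof.
split=> [h2|h1].
  apply: (bilin_l _ (tensB _ _)).
  apply: (bilin_r _ mB); exact: (actB.1 v).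
apply: (bilin_r _ (tensB _ _)); exact: ((mulB H).1 l).
Qed.

Lemma smash_coreB_vl u h :
  bilinear (fun v l => \sw_(h1, h2 <- h) (m u (act h1 v) *t (h2 * l))).
Proof.
split=> [l|v]; apply: lin_tlift => h1 h2.
  apply: (bilin_l _ (tensB _ _)).
  apply: (bilin_r _ mB); exact: (actB.2 h1).
apply: (bilin_r _ (tensB _ _)); exact: ((mulB H).2 h2).
Qed.

Lemma smash_coreB_uh t :
  bilinear (fun u h => tlift (fun v l =>
    \sw_(h1, h2 <- h) (m u (act h1 v) *t (h2 * l))) t).
Proof.
split=> [h|u]; apply: lin_tlift => v l.
  apply: lin_tlift => h1 h2.
  apply: (bilin_l _ (tensB _ _)); exact: (mB.1 (act h1 v)).
apply: sw_linear; exact: smash_coreB_h.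
Qed.

Lemma smash_mulB : bilinear (smash_mul m act).
Proof.
split=> [t|s]; first exact: (tlift_lin (smash_coreB_uh t)).
apply: lin_tlift => u h; exact: (tlift_lin (smash_coreB_vl u h)).
Qed.

Lemma smash_mulE u h v l : smash_mul m act (u *t h) (v *t l) =
  \sw_(h1, h2 <- h) (m u (act h1 v) *t (h2 * l)).
Proof.
rewrite /smash_mul tliftE; last exact: smash_coreB_uh.
by rewrite tliftE //; apply: smash_coreB_vl.
Qed.

End Bilinearity.

Section Associativity.
Variables (U1 U2 U3 U12 U23 U123 : lmodType k).
Variables (m12 : U1 -> U2 -> U12) (m12_3 : U12 -> U3 -> U123).
Variables (m23 : U2 -> U3 -> U23) (m1_23 : U1 -> U23 -> U123).
Variables (a2 : H -> U2 -> U2) (a3 : H -> U3 -> U3) (a23 : H -> U23 -> U23).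
Hypotheses (m12B : bilinear m12) (m12_3B : bilinear m12_3).
Hypotheses (m23B : bilinear m23) (m1_23B : bilinear m1_23).
Hypotheses (a2B : bilinear a2) (a3B : bilinear a3) (a23B : bilinear a23).
Hypothesis mA : forall x y z, m12_3 (m12 x y) z = m1_23 x (m23 y z).
Hypothesis aM : forall h l y z,
  a23 h (m23 y (a3 l z)) = \sw_(h1, h2 <- h) m23 (a2 h1 y) (a3 (h2 * l) z).

Lemma smash_mulA s t u : smash_mul m12_3 a3 (smash_mul m12 a2 s t) u =
  smash_mul m1_23 a23 s (smash_mul m23 a3 t u).
Proof.
have B1 := smash_mulB m12B a2B; have B2 := smash_mulB m12_3B a3B.
have B3 := smash_mulB m23B a3B; have B4 := smash_mulB m1_23B a23B.
move: s; apply: tensP => [||x h].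
- apply: (bilin_l _ B2); exact: (B1.1 t).
- exact: (B4.1 _).
move: t; apply: tensP => [||y l].
- apply: (bilin_l _ B2); exact: (B1.2 _).
- apply: (bilin_r _ B4); exact: (B3.1 _).
move: u; apply: tensP => [||z r].
- exact: (B2.2 _).
- apply: (bilin_r _ B4); exact: (B3.2 _).
rewrite !smash_mulE // (tlift_comp _ _ (B2.1 _)) (tlift_comp _ _ (B4.2 _)).
transitivity (\sw_(h1, h2 <- h) \sw_(p, q <- h2) \sw_(l1, l2 <- l)
  (m1_23 x (m23 (a2 h1 y) (a3 (p * l1) z)) *t (q * l2 * r))).
  apply: eq_tlift => h1 h2; rewrite smash_mulE // swM; last first.
    exact: (smash_coreB_h m12_3B a3B).
  by apply: eq_tlift => p q; apply: eq_tlift => l1 l2; rewrite mA.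
rewrite -(swA (F := fun h1 p q => \sw_(l1, l2 <- l)
  (m1_23 x (m23 (a2 h1 y) (a3 (p * l1) z)) *t (q * l2 * r)))).
- under [RHS]eq_tlift => l1 l2 do rewrite smash_mulE //.
  rewrite tlift_exchange; apply: eq_tlift => h1 h2.
  rewrite tlift_exchange; apply: eq_tlift => l1 l2.
  rewrite aM (tlift_comp _ _ (m1_23B.2 x)).
  rewrite (tlift_comp (g := fun w => w *t _)); last exact: ((tensB _ _).1 _).
  by apply: eq_tlift => p q; rewrite mulrA.
- move=> q; split=> [p|h1]; apply: lin_tlift => l1 l2;
    apply: (bilin_l _ (tensB _ _)); apply: (bilin_r _ m1_23B).
    apply: (bilin_l _ m23B); exact: (a2B.1 y).
  apply: (bilin_r _ m23B); apply: (bilin_l _ a3B); exact: ((mulB H).1 l1).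
- move=> h1 p; apply: lin_tlift => l1 l2; apply: (bilin_r _ (tensB _ _)).
  apply: (bilin_l _ (mulB H)); exact: ((mulB H).1 l2).
Qed.

End Associativity.
End SmashProduct.

(* Associative algebras, not necessarily unital. *)
Record nuAlgebra (k : fieldType) := NuAlgebra {
  nu_mod :> lmodType k;
  numul : nu_mod -> nu_mod -> nu_mod;
  numulB : bilinear numul;
  numulA : associative numul }.

Infix "**" := numul (at level 40, left associativity) : ring_scope.

Section PartialActions.
Variables (k : fieldType) (H : hopfAlgebra k) (A : nuAlgebra k).

(* A linear map H (x) A -> A, given as a bilinear map. *)
Record partialAction := PartialAction {
  pact :> H -> A -> A;
  pactB : bilinear pact;
  pact1 : forall a, pact 1 a = a;
  pactM : forall h l a b, pact h (a ** pact l b) =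
    \sw_(h1, h2 <- h) (pact h1 a ** pact (h2 * l) b) }.

Definition symmetrical (act : partialAction) : Prop := forall h l a b,
  act h (act l b ** a) = \sw_(h1, h2 <- h) (act (h1 * l) b ** act h2 a).

(* With F empty, lu_unit makes Lam nonempty. The family e may have repetitions. *)
Record localUnits (Lam : Type) (e : Lam -> A) : Prop := LocalUnits {
  lu_idem : forall i, e i ** e i = e i;
  lu_unit : forall F : seq A, exists i,
    {in F, forall a, e i ** a = a /\ a ** e i = a} }.

Definition corner_set (p q : A) : set A := [set x | exists a, x = p ** a ** q].

Lemma corner_set0 p q : corner_set p q 0.
Proof.
by exists 0; rewrite (lin0 ((numulB A).2 p)) (lin0 ((numulB A).1 q)).
Qed.

Lemma corner_setP p q c u v :
  corner_set p q u -> corner_set p q v -> corner_set p q (c *: u + v).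
Proof.
move=> [a ->] [b ->]; exists (c *: a + b).
by rewrite ((numulB A).2 p) ((numulB A).1 q).
Qed.

Definition corner (p q : A) : subspace A :=
  Subspace (@corner_set0 p q) (@corner_setP p q).

Definition categorizable (act : partialAction) (Lam : Type) (e : Lam -> A) :=
  forall i h, corner (e i) (e i) (act h (e i)).

End PartialActions.

Section PartialSmash.
Variables (k : fieldType) (H : hopfAlgebra k) (A : nuAlgebra k).
Variable act : partialAction H A.

Definition smashB := smash_mulB (numulB A) (pactB act).

Lemma full_smashA : associative (smash_mul (@numul k A) act).
Proof.
move=> s t u; apply/esym/smash_mulA; try exact: (numulB A); try exact: pactB.
  by move=> x y z; rewrite numulA.
exact: pactM.
Qed.

Definition fullSmash : nuAlgebra k := NuAlgebra smashB full_smashA.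

(* The subspace (A # H)(A # 1) of A # H, by its spanning set. *)
Definition partial_smash_space : subspace fullSmash :=
  lspan [set t : fullSmash | exists a b h,
    t = \sw_(h1, h2 <- h) ((a ** act h1 b) *t h2)].

Lemma partial_smash_gen a b h :
  \sw_(h1, h2 <- h) ((a ** act h1 b) *t h2) =
  ((a *t h : fullSmash) ** (b *t 1 : fullSmash)).
Proof.
rewrite [RHS]smash_mulE; [|exact: (numulB A)|exact: pactB].
by apply: eq_tlift => h1 h2; rewrite mulr1.
Qed.

Lemma partial_smash_mul (x y : fullSmash) :
  partial_smash_space y -> partial_smash_space (x ** y).
Proof.
move: y; apply: lspan_image; first exact: ((numulB fullSmash).2 x).
move=> _ [a [b [h ->]]]; rewrite partial_smash_gen numulA.
move: (x ** _) => t; rewrite [t]tens_sum.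
rewrite (tlift_comp _ _ ((numulB fullSmash).1 _)).
apply: subspace_tlift => c l; apply: sub_lspan; exists c, b, l.
by rewrite partial_smash_gen.
Qed.

Definition partial_smash_op (x y : subsp partial_smash_space) :
    subsp partial_smash_space :=
  mk_subsp (partial_smash_mul (val x) (subspP y)).

Lemma partial_smash_opB : bilinear partial_smash_op.
Proof.
split=> [y|x] a u v; apply: val_inj.
  exact: ((numulB (fullSmash)).1 (val y)).
exact: ((numulB (fullSmash)).2 (val x)).
Qed.

Lemma partial_smash_opA : associative partial_smash_op.
Proof. by move=> x y z; apply: val_inj; exact: (numulA (n := fullSmash)). Qed.

Definition partialSmash : nuAlgebra k :=
  NuAlgebra partial_smash_opB partial_smash_opA.

End PartialSmash.

Record kcategory (k : fieldType) := KCategory {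
  kobj :> Type;
  khom : kobj -> kobj -> lmodType k;
  kid : forall x, khom x x;
  kcomp : forall x y z, khom y z -> khom x y -> khom x z;
  kcompB : forall x y z, bilinear (@kcomp x y z);
  kcompA : forall x y z t (h : khom z t) (g : khom y z) (f : khom x y),
    kcomp h (kcomp g f) = kcomp (kcomp h g) f;
  kid_l : forall x y (f : khom x y), kcomp (kid y) f = f;
  kid_r : forall x y (f : khom x y), kcomp f (kid x) = f }.

Infix "\ok" := kcomp (at level 40, left associativity) : ring_scope.

Section SmashCategory.
Variables (k : fieldType) (H : hopfAlgebra k) (C : kcategory k).

Record catPartialAction := CatPartialAction {
  cact : forall x y : C, H -> khom x y -> khom x y;
  cactB : forall x y, bilinear (@cact x y);
  cact1 : forall x y (f : khom x y), cact 1 f = f;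
  cactM : forall x y z h l (g : khom y z) (f : khom x y),
    cact h (g \ok cact l f) = \sw_(h1, h2 <- h) (cact h1 g \ok cact (h2 * l) f) }.

Variable act : catPartialAction.

Definition smash_hom (x y : C) : subspace (khom x y *t H)%type :=
  lspan [set t | exists (f : khom x y) h,
    t = \sw_(h1, h2 <- h) ((f \ok cact act h1 (kid x)) *t h2)].

Definition full_smash_comp (x y z : C) (t : khom y z *t H) (s : khom x y *t H) :
    khom x z *t H :=
  smash_mul (@kcomp k C x y z) (@cact act x y) t s.

Lemma full_smash_compB x y z : bilinear (@full_smash_comp x y z).
Proof. exact: smash_mulB (@kcompB k C x y z) (@cactB act x y). Qed.

Lemma full_smash_compA x y z w (u : khom z w *t H) (t : khom y z *t H)
    (s : khom x y *t H) :
  full_smash_comp u (full_smash_comp t s) =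
  full_smash_comp (full_smash_comp u t) s.
Proof.
apply/esym/smash_mulA; try exact: kcompB; try exact: cactB.
  by move=> a b c; rewrite kcompA.
exact: cactM.
Qed.

Lemma smash_hom_gen x y (f : khom x y) h :
  \sw_(h1, h2 <- h) ((f \ok cact act h1 (kid x)) *t h2) =
  full_smash_comp (f *t h) (kid x *t 1).
Proof.
rewrite /full_smash_comp smash_mulE; [|exact: kcompB|exact: cactB].
by apply: eq_tlift => h1 h2; rewrite mulr1.
Qed.

Lemma smash_hom_id_r x y (t : khom x y *t H) :
  smash_hom x y (full_smash_comp t (kid x *t 1)).
Proof.
rewrite [t]tens_sum (tlift_comp _ _ ((full_smash_compB x x y).1 _)).
apply: subspace_tlift => f h; apply: sub_lspan; exists f, h.
by rewrite smash_hom_gen.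
Qed.

Lemma smash_hom_id x : smash_hom x x (kid x *t 1).
Proof.
apply: sub_lspan; exists (kid x), 1; rewrite sw1 ?cact1 ?kid_l //.
split=> [h2|h1]; last exact: ((tensB _ _).2 _).
apply: (bilin_l _ (tensB _ _)); apply: (bilin_r _ (kcompB _ _ _)).
exact: ((cactB act _ _).1 _).
Qed.

Lemma smash_hom_comp x y z (t : khom y z *t H) (s : khom x y *t H) :
  smash_hom x y s -> smash_hom x z (full_smash_comp t s).
Proof.
move: s; apply: lspan_image; first exact: ((full_smash_compB x y z).2 t).
move=> _ [f [h ->]]; rewrite smash_hom_gen full_smash_compA.
exact: smash_hom_id_r.
Qed.

Definition smash_id (x : C) : subsp (smash_hom x x) :=
  mk_subsp (@smash_hom_id x).

Definition smash_comp (x y z : C)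
    (t : subsp (smash_hom y z)) (s : subsp (smash_hom x y)) :
    subsp (smash_hom x z) :=
  mk_subsp (@smash_hom_comp x y z (val t) (val s) (subspP s)).

Lemma smash_compB x y z : bilinear (@smash_comp x y z).
Proof.
split=> [s|t] a u v; apply: val_inj.
  exact: ((full_smash_compB x y z).1 (val s)).
exact: ((full_smash_compB x y z).2 (val t)).
Qed.

Lemma smash_compA x y z w (u : subsp (smash_hom z w))
    (t : subsp (smash_hom y z)) (s : subsp (smash_hom x y)) :
  smash_comp u (smash_comp t s) = smash_comp (smash_comp u t) s.
Proof. by apply: val_inj; exact: full_smash_compA. Qed.

Lemma full_smash_id_l x y (t : khom x y *t H) :
  full_smash_comp (kid y *t 1) t = t.
Proof.
move: t; apply: tensP => [||f h]; [exact: ((full_smash_compB x y y).2 _)|by []|].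
rewrite /full_smash_comp smash_mulE; [|exact: kcompB|exact: cactB].
rewrite sw1 ?cact1 ?kid_l ?mul1r //.
exact: (smash_coreB_h (kcompB _ _ _) (cactB act _ _)).
Qed.

Lemma smash_id_l x y (t : subsp (smash_hom x y)) :
  smash_comp (smash_id y) t = t.
Proof. by apply: val_inj; exact: full_smash_id_l. Qed.

Lemma smash_id_r x y (t : subsp (smash_hom x y)) :
  smash_comp t (smash_id x) = t.
Proof.
have id_r s : smash_hom x y s -> full_smash_comp s (kid x *t 1) = s.
  pose R (s' : khom x y *t H) := full_smash_comp s' (kid x *t 1 : khom x x *t H).
  have RL : linear R by exact: ((full_smash_compB x x y).1 _).
  move: s; apply: (lspan_ext RL (@lin_id _ _)) => _ [f [h ->]].
  by rewrite /R smash_hom_gen -full_smash_compA full_smash_id_l.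
by apply: val_inj; apply: id_r (subspP t).
Qed.

Definition smash_category : kcategory k := KCategory smash_compB
  (fun x y z w h g f => smash_compA h g f) smash_id_l smash_id_r.

End SmashCategory.

Section CornerCategory.
Variables (k : fieldType) (A : nuAlgebra k) (Lam : Type) (e : Lam -> A).
Hypothesis eS : localUnits e.

Lemma corner_l i j x : corner (e j) (e i) x -> e j ** x = x.
Proof. by move=> [a ->]; rewrite !numulA (lu_idem eS). Qed.

Lemma corner_r i j x : corner (e j) (e i) x -> x ** e i = x.
Proof. by move=> [a ->]; rewrite -!numulA (lu_idem eS). Qed.

Lemma cornerI i j x : e j ** x = x -> x ** e i = x -> corner (e j) (e i) x.
Proof. by move=> xl xr; exists x; rewrite xl xr. Qed.

Lemma corner_mul i j l x y : corner (e l) (e j) x -> corner (e j) (e i) y ->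
  corner (e l) (e i) (x ** y).
Proof.
move=> xP yP; apply: cornerI; first by rewrite numulA (corner_l xP).
by rewrite -numulA (corner_r yP).
Qed.

Lemma corner_idem i : corner (e i) (e i) (e i).
Proof. by apply: cornerI; rewrite (lu_idem eS). Qed.

(* Morphisms from i to j are the elements of e_j A e_i. *)
Definition corner_hom (i j : Lam) : lmodType k := subsp (corner (e j) (e i)).

Definition corner_id (i : Lam) : corner_hom i i := mk_subsp (corner_idem i).

Definition corner_comp i j l (g : corner_hom j l) (f : corner_hom i j) :
    corner_hom i l :=
  mk_subsp (corner_mul (subspP g) (subspP f)).

Lemma corner_compB i j l : bilinear (@corner_comp i j l).
Proof.
split=> [f|g] a u v; apply: val_inj.
  exact: ((numulB A).1 (val f)).
exact: ((numulB A).2 (val g)).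
Qed.

Lemma corner_compA i j l m (h : corner_hom l m) (g : corner_hom j l)
    (f : corner_hom i j) :
  corner_comp h (corner_comp g f) = corner_comp (corner_comp h g) f.
Proof. by apply: val_inj; exact: numulA. Qed.

Lemma corner_id_l i j (f : corner_hom i j) : corner_comp (corner_id j) f = f.
Proof. by apply: val_inj; exact: (corner_l (subspP f)). Qed.

Lemma corner_id_r i j (f : corner_hom i j) : corner_comp f (corner_id i) = f.
Proof. by apply: val_inj; exact: (corner_r (subspP f)). Qed.

Definition corner_category : kcategory k := KCategory corner_compB
  (fun i j l m h g f => corner_compA h g f) corner_id_l corner_id_r.

Variables (H : hopfAlgebra k) (act : partialAction H A).
Hypothesis eC : categorizable act e.

Lemma pact_mul h a b : act h (a ** b) = \sw_(h1, h2 <- h) (act h1 a ** act h2 b).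
Proof.
rewrite -{1}[b](pact1 act) pactM.
by apply: eq_tlift => h1 h2; rewrite mulr1.
Qed.

Lemma pact_corner i j h x :
  corner (e j) (e i) x -> corner (e j) (e i) (act h x).
Proof.
move=> xP; apply: cornerI.
  rewrite -(corner_l xP) pact_mul (tlift_comp _ _ ((numulB A).2 _)).
  by apply: eq_tlift => h1 h2; rewrite numulA (corner_l (eC j h1)).
rewrite -(corner_r xP) pact_mul (tlift_comp _ _ ((numulB A).1 _)).
by apply: eq_tlift => h1 h2; rewrite -numulA (corner_r (eC i h2)).
Qed.

Definition corner_act (i j : corner_category) (h : H) (f : corner_hom i j) :
    corner_hom i j :=
  mk_subsp (pact_corner h (subspP f)).

Lemma corner_actB i j : bilinear (@corner_act i j).
Proof.
split=> [f|h] a u v; apply: val_inj.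
  exact: ((pactB act).1 (val f)).
exact: ((pactB act).2 h).
Qed.

Lemma corner_act1 i j (f : corner_hom i j) : corner_act 1 f = f.
Proof. by apply: val_inj; exact: pact1. Qed.

Lemma corner_actM i j l h h' (g : corner_hom j l) (f : corner_hom i j) :
  corner_act h (corner_comp g (corner_act h' f)) =
  \sw_(h1, h2 <- h) (corner_comp (corner_act h1 g) (corner_act (h2 * h') f)).
Proof.
apply: val_inj; rewrite (tlift_comp (g := val)) //; exact: (pactM act).
Qed.

Definition corner_action : catPartialAction H corner_category :=
  @CatPartialAction k H corner_category corner_act corner_actB corner_act1
    corner_actM.

End CornerCategory.

Record category := Category {
  cobj :> Type;
  chom : cobj -> cobj -> Type;
  cid : forall x, chom x x;
  ccomp : forall x y z, chom y z -> chom x y -> chom x z;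
  ccompA : forall x y z t (h : chom z t) (g : chom y z) (f : chom x y),
    ccomp h (ccomp g f) = ccomp (ccomp h g) f;
  cid_l : forall x y (f : chom x y), ccomp (cid y) f = f;
  cid_r : forall x y (f : chom x y), ccomp f (cid x) = f }.

Infix "\oc" := ccomp (at level 40, left associativity).

Section Functors.
Variables C D : category.

Record functor := Functor {
  fobj :> C -> D;
  fmap : forall x y, chom x y -> chom (fobj x) (fobj y);
  fmap_id : forall x, fmap (cid x) = cid (fobj x);
  fmap_comp : forall x y z (g : chom y z) (f : chom x y),
    fmap (g \oc f) = fmap g \oc fmap f }.

Definition iso (x y : C) (f : chom x y) : Prop :=
  exists g : chom y x, g \oc f = cid x /\ f \oc g = cid y.

End Functors.

Definition natural_iso (C D : category) (F G : functor C D) : Prop :=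
  exists eta : forall x, chom (F x) (G x),
    (forall x y (f : chom x y), eta y \oc fmap F f = fmap G f \oc eta x) /\
    (forall x, iso (eta x)).

Definition functor_id (C : category) : functor C C :=
  @Functor C C id (fun x y f => f) (fun x => erefl) (fun x y z g f => erefl).

Section FunctorComposition.
Variables (C D E : category) (G : functor D E) (F : functor C D).

Lemma functor_comp_id x : fmap G (fmap F (cid x)) = cid (G (F x)).
Proof. by rewrite !fmap_id. Qed.

Lemma functor_comp_comp x y z (g : chom y z) (f : chom x y) :
  fmap G (fmap F (g \oc f)) = fmap G (fmap F g) \oc fmap G (fmap F f).
Proof. by rewrite !fmap_comp. Qed.

Definition functor_comp : functor C E :=
  @Functor C E (fun x => G (F x)) (fun x y f => fmap G (fmap F f))
    functor_comp_id functor_comp_comp.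

End FunctorComposition.

Definition equivalent (C D : category) : Prop :=
  exists (F : functor C D) (G : functor D C),
    natural_iso (functor_comp G F) (functor_id C) /\
    natural_iso (functor_comp F G) (functor_id D).

Section UnitalModules.
Variables (k : fieldType) (R : nuAlgebra k).

Record leftModule := LeftModule {
  lm_mod :> lmodType k;
  lm_act : R -> lm_mod -> lm_mod;
  lm_actB : bilinear lm_act;
  lm_actA : forall r s m, lm_act (r ** s) m = lm_act r (lm_act s m) }.

(* RM is the span of the elements r m. *)
Definition unital (M : leftModule) : Prop :=
  forall m : M, lspan [set x | exists r n, x = lm_act r n] m.

Record unitalModule := UnitalModule {
  um_mod :> leftModule;
  um_unital : unital um_mod }.

Record moduleHom (M N : leftModule) := ModuleHom {
  mh_fun :> M -> N;
  mh_linear : linear mh_fun;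
  mh_act : forall r m, mh_fun (lm_act r m) = lm_act r (mh_fun m) }.

Lemma moduleHom_eq M N (f g : moduleHom M N) : f =1 g -> f = g.
Proof.
case: f g => [f fL fA] [g gL gA] /= /funext fg; subst g.
by congr ModuleHom; exact: Prop_irrelevance.
Qed.

Definition moduleHom_id M : moduleHom M M :=
  @ModuleHom M M id (@lin_id k M) (fun r m => erefl).

Lemma moduleHom_comp_act M N P (g : moduleHom N P) (f : moduleHom M N) r m :
  g (f (lm_act r m)) = lm_act r (g (f m)).
Proof. by rewrite !mh_act. Qed.

Definition moduleHom_comp M N P (g : moduleHom N P) (f : moduleHom M N) :
    moduleHom M P :=
  @ModuleHom M P (fun m => g (f m)) (lin_comp (mh_linear g) (mh_linear f))
    (moduleHom_comp_act g f).

Lemma moduleHom_compA M N P Q (h : moduleHom P Q) (g : moduleHom N P)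
    (f : moduleHom M N) :
  moduleHom_comp h (moduleHom_comp g f) = moduleHom_comp (moduleHom_comp h g) f.
Proof. exact: moduleHom_eq. Qed.

Lemma moduleHom_id_l M N (f : moduleHom M N) :
  moduleHom_comp (moduleHom_id N) f = f.
Proof. exact: moduleHom_eq. Qed.

Lemma moduleHom_id_r M N (f : moduleHom M N) :
  moduleHom_comp f (moduleHom_id M) = f.
Proof. exact: moduleHom_eq. Qed.

Definition unitalModuleCategory : category :=
  @Category unitalModule (fun M N => moduleHom M N)
    (fun M => moduleHom_id M) (fun M N P g f => moduleHom_comp g f)
    (fun M N P Q h g f => moduleHom_compA h g f)
    (fun M N f => moduleHom_id_l f) (fun M N f => moduleHom_id_r f).

End UnitalModules.

Section CategoryModules.
Variables (k : fieldType) (C : kcategory k).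

(* A k-linear functor to vector spaces: cm_mapB says both that each cm_map f is
   linear and that it depends linearly on f. *)
Record catModule := CatModule {
  cm_obj :> C -> lmodType k;
  cm_map : forall x y, khom x y -> cm_obj x -> cm_obj y;
  cm_mapB : forall x y, bilinear (@cm_map x y);
  cm_map_id : forall x m, cm_map (kid x) m = m;
  cm_map_comp : forall x y z (g : khom y z) (f : khom x y) m,
    cm_map (g \ok f) m = cm_map g (cm_map f m) }.

Record catModuleHom (M N : catModule) := CatModuleHom {
  cmh_fun :> forall x, M x -> N x;
  cmh_linear : forall x, linear (@cmh_fun x);
  cmh_natural : forall x y (f : khom x y) m,
    cmh_fun (cm_map f m) = cm_map f (cmh_fun m) }.

Lemma catModuleHom_eq M N (f g : catModuleHom M N) :
  (forall x, f x =1 g x) -> f = g.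
Proof.
case: f g => [f fL fN] [g gL gN] /= fg.
have {}fg : f = g by apply: functional_extensionality_dep => x; exact/funext.
by subst g; congr CatModuleHom; exact: Prop_irrelevance.
Qed.

Definition catModuleHom_id M : catModuleHom M M :=
  @CatModuleHom M M (fun x m => m) (fun x => @lin_id k (M x))
    (fun x y f m => erefl).

Lemma catModuleHom_comp_natural M N P (g : catModuleHom N P)
    (f : catModuleHom M N) x y (u : khom x y) m :
  g y (f y (cm_map u m)) = cm_map u (g x (f x m)).
Proof. by rewrite !cmh_natural. Qed.

Definition catModuleHom_comp M N P (g : catModuleHom N P)
    (f : catModuleHom M N) : catModuleHom M P :=
  @CatModuleHom M P (fun x m => g x (f x m))
    (fun x => lin_comp (@cmh_linear _ _ g x) (@cmh_linear _ _ f x))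
    (catModuleHom_comp_natural g f).

Lemma catModuleHom_compA M N P Q (h : catModuleHom P Q)
    (g : catModuleHom N P) (f : catModuleHom M N) :
  catModuleHom_comp h (catModuleHom_comp g f) =
  catModuleHom_comp (catModuleHom_comp h g) f.
Proof. exact: catModuleHom_eq. Qed.

Lemma catModuleHom_id_l M N (f : catModuleHom M N) :
  catModuleHom_comp (catModuleHom_id N) f = f.
Proof. exact: catModuleHom_eq. Qed.

Lemma catModuleHom_id_r M N (f : catModuleHom M N) :
  catModuleHom_comp f (catModuleHom_id M) = f.
Proof. exact: catModuleHom_eq. Qed.

Definition catModuleCategory : category :=
  @Category catModule catModuleHom catModuleHom_id catModuleHom_comp
    (fun M N P Q h g f => catModuleHom_compA h g f)
    (fun M N f => catModuleHom_id_l f) (fun M N f => catModuleHom_id_r f).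

End CategoryModules.

(* Main.v *)
(* The elements e_i # 1 form a system of local units of the partial smash
   product R, and the S-categorizability of the action makes the morphism space
   from i to j of the smash category equal to the Peirce corner
   (e_j # 1) R (e_i # 1).  For any algebra R with local units eps_i, unital
   modules over R are the same as modules over the category of these corners:
   M is sent to the family of the eps_i M, and a module N over the category to
   the direct limit of the N i, with R acting by
   (r n)_j = N(eps_j r eps_i) n_i. *)

From HB Require Import structures.
From mathcomp Require Import all_boot all_algebra.
From mathcomp Require Import boolp classical_sets.
Require Import Defs.

Set Implicit Arguments.
Unset Strict Implicit.
Unset Printing Implicit Defensive.

Import GRing.Theory.
Local Open Scope ring_scope.

(** * Products of families of vector spaces *)

Section DependentProduct.
Variables (k : fieldType) (I : Type) (N : I -> lmodType k).

(** A named constant for the dependent function type, so that the pointwise vector space structure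
    can be attached to it. *)
Definition dprod : Type := forall i, N i.
HB.instance Definition _ := Choice.on dprod.

Lemma dprod_ext (f g : dprod) : (forall i, f i = g i) -> f = g.
Proof. exact: functional_extensionality_dep. Qed.

Definition dprod_add (f g : dprod) : dprod := fun i => f i + g i.
Definition dprod_opp (f : dprod) : dprod := fun i => - f i.
Definition dprod_scale (a : k) (f : dprod) : dprod := fun i => a *: f i.

Lemma dprod_addA : associative dprod_add.
Proof. by move=> f g h; apply: dprod_ext => i; exact: addrA. Qed.

Lemma dprod_addC : commutative dprod_add.
Proof. by move=> f g; apply: dprod_ext => i; exact: addrC. Qed.

Lemma dprod_add0 : left_id (fun i => 0) dprod_add.
Proof. by move=> f; apply: dprod_ext => i; exact: add0r. Qed.

Lemma dprod_addN : left_inverse (fun i => 0) dprod_opp dprod_add.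
Proof. by move=> f; apply: dprod_ext => i; exact: addNr. Qed.

HB.instance Definition _ :=
  GRing.isZmodule.Build dprod dprod_addA dprod_addC dprod_add0 dprod_addN.

Lemma dprod_scaleA a b f :
  dprod_scale a (dprod_scale b f) = dprod_scale (a * b) f.
Proof. by apply: dprod_ext => i; exact: scalerA. Qed.

Lemma dprod_scale1 : left_id 1 dprod_scale.
Proof. by move=> f; apply: dprod_ext => i; exact: scale1r. Qed.

Lemma dprod_scaleDr : right_distributive dprod_scale +%R.
Proof. by move=> a f g; apply: dprod_ext => i; exact: scalerDr. Qed.

Lemma dprod_scaleDl f : {morph dprod_scale^~ f : a b / a + b}.
Proof. by move=> a b; apply: dprod_ext => i; exact: scalerDl. Qed.

HB.instance Definition _ := GRing.Zmodule_isLmodule.Build k dprod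
  dprod_scaleA dprod_scale1 dprod_scaleDr dprod_scaleDl.

End DependentProduct.

(** * Inverses of bijective morphisms and of natural isomorphisms *)

Lemma choice_dep (I : Type) (T : I -> Type) (P : forall i, T i -> Prop) :
  (forall i, exists t, P i t) -> exists f : forall i, T i, forall i, P i (f i).
Proof.
move=> H; exists (fun i => sval (boolp.cid (H i))) => i.
exact: (svalP (boolp.cid (H i))).
Qed.

Section Inverses.
Variable k : fieldType.

Lemma linear_inverse (V W : lmodType k) (f : V -> W) (g : W -> V) :
  linear f -> cancel f g -> cancel g f -> linear g.
Proof. by move=> fL fK gK a u v; rewrite -{1}[u]gK -{1}[v]gK -fL fK. Qed.

Lemma bijective_inverse (V W : Type) (f : V -> W) :
  injective f -> (forall w, exists v, f v = w) ->
  exists g, cancel f g /\ cancel g f.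
Proof.
move=> fI fS; have [g gK] := choice fS; exists g; split=> // v.
by apply: fI; rewrite gK.
Qed.

Lemma moduleHom_iso (R : nuAlgebra k) (M N : unitalModuleCategory R)
    (f : moduleHom M N) :
  injective f -> (forall n, exists m, f m = n) -> iso (C := unitalModuleCategory R) f.
Proof.
move=> fI /(bijective_inverse fI) [g [fK gK]].
have gA r n : g (lm_act r n) = lm_act r (g n) by rewrite -{1}[n]gK -mh_act fK.
exists (ModuleHom (linear_inverse (mh_linear f) fK gK) gA).
by split; [apply: (@moduleHom_eq _ _ M M)|apply: (@moduleHom_eq _ _ N N)].
Qed.

Lemma catModuleHom_iso (C : kcategory k) (M N : catModuleCategory C)
    (f : catModuleHom M N) :
  (forall x, injective (@cmh_fun _ _ _ _ f x)) ->
  (forall x n, exists m, f x m = n) -> iso (C := catModuleCategory C) f.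
Proof.
move=> fI fS.
have [g gP] := choice_dep (fun x => bijective_inverse (@fI x) (fS x)).
have fK x := (gP x).1; have gK x := (gP x).2.
have gN x y (u : khom x y) n : g y (cm_map u n) = cm_map u (g x n).
  by rewrite -{1}[n]gK -cmh_natural fK.
exists (@CatModuleHom _ _ N M g
  (fun x => linear_inverse (@cmh_linear _ _ _ _ f x) (fK x) (gK x)) gN).
by split; [apply: (@catModuleHom_eq _ _ M M)|apply: (@catModuleHom_eq _ _ N N)].
Qed.

End Inverses.

(** The inverses of the components are again natural. This serves to orient the unit, which goes
    from the identity to the composite, while [equivalent] asks for the other direction. *)
Lemma natural_iso_sym (C D : category) (F G : functor C D) :
  natural_iso F G -> natural_iso G F.
Proof.
move=> [eta [etaN etaI]].
have [th thP] := choice_dep etaI.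
exists th; split=> [x y f|x]; last by exists (eta x); case: (thP x).
have [_ ex] := thP x; have [ey _] := thP y.
rewrite -[LHS]cid_r -ex ccompA -(ccompA (th y)) -etaN !ccompA ey cid_l.
by [].
Qed.

(** * Modules over an algebra with local units and modules over its category of corners *)

Section CornerEquivalence.
Variables (k : fieldType) (R : nuAlgebra k) (C : kcategory k).
(** [phi] embeds the morphisms from [x] to [y] into [R], with image the corner
    [eps y ** R ** eps x]. [psi x y] is defined on all of [R]: it compresses an element to this
    corner and reads the result as a morphism. Its linearity follows from the injectivity of
    [phi]. *)
Variables (phi : forall x y : C, khom x y -> R) (psi : forall x y : C, R -> khom x y).
Local Notation eps x := (phi (kid x)).
Hypothesis phiL : forall x y, linear (@phi x y).
Hypothesis phi_inj : forall x y, injective (@phi x y).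
Hypothesis phi_comp : forall x y z (g : khom y z) (f : khom x y),
  phi (g \ok f) = phi g ** phi f.
Hypothesis psiK : forall x y r, phi (psi x y r) = eps y ** r ** eps x.
Hypothesis epsS : localUnits (fun x => eps x).

Lemma eps_phi x y (f : khom x y) : eps y ** phi f = phi f.
Proof. by rewrite -phi_comp kid_l. Qed.

Lemma phi_eps x y (f : khom x y) : phi f ** eps x = phi f.
Proof. by rewrite -phi_comp kid_r. Qed.

Lemma eps_idem x : eps x ** eps x = eps x.
Proof. exact: eps_phi. Qed.

Lemma phiK x y : cancel (@phi x y) (psi x y).
Proof. by move=> f; apply: phi_inj; rewrite psiK eps_phi phi_eps. Qed.

Lemma psiL x y : linear (psi x y).
Proof.
move=> a r s; apply: phi_inj; rewrite phiL !psiK.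
by rewrite ((numulB R).2 (eps y)) ((numulB R).1 (eps x)).
Qed.

(** Compression is not multiplicative in general: the composite puts [eps y] between [r] and [s]. It
    disappears when [s] absorbs it from the left or, in [psi_compr], when [r] absorbs it from the
    right. *)
Lemma psi_comp x y z r s : eps y ** s = s ->
  psi y z r \ok psi x y s = psi x z (r ** s).
Proof.
move=> ys; apply: phi_inj; rewrite phi_comp !psiK -!numulA.
by rewrite [eps y ** (eps y ** _)]numulA eps_idem [eps y ** _]numulA ys.
Qed.

Lemma psi_compr x y z r s : r ** eps y = r ->
  psi y z r \ok psi x y s = psi x z (r ** s).
Proof.
move=> ry; apply: phi_inj; rewrite phi_comp !psiK -!numulA.
rewrite [eps y ** (eps y ** _)]numulA eps_idem [r ** (eps y ** _)]numulA ry.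
by [].
Qed.

(** Applied to two idempotents [eps x] and [eps y], this says that the local units are directed. *)
Lemma common_unit r s : exists x,
  [/\ eps x ** r = r, r ** eps x = r, eps x ** s = s & s ** eps x = s].
Proof.
have [x xP] := lu_unit epsS [:: r; s].
have [|xr rx] := xP r; first by rewrite !inE eqxx.
have [|xs sx] := xP s; first by rewrite !inE eqxx orbT.
by exists x.
Qed.

(** * From modules over the algebra to modules over the category of corners *)

Section Peirce.
Variable M : leftModule R.

Lemma peirce_set0 x : lm_act (eps x) (0 : M) = 0.
Proof. exact: (lin0 ((lm_actB M).2 _)). Qed.

Lemma peirce_setP x a (u v : M) : lm_act (eps x) u = u -> lm_act (eps x) v = v ->
  lm_act (eps x) (a *: u + v) = a *: u + v.
Proof. by move=> xu xv; rewrite ((lm_actB M).2 _) xu xv. Qed.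

(** As [eps x] is idempotent, its fixed vectors are exactly the subspace [eps x M]. *)
Definition peirce x : subspace M := Subspace (peirce_set0 x) (@peirce_setP x).

Lemma peirceE x (m : subsp (peirce x)) : lm_act (eps x) (val m) = val m.
Proof. exact: subspP m. Qed.

Lemma peirce_act x y (f : khom x y) (m : M) : peirce y (lm_act (phi f) m).
Proof. by rewrite /= -lm_actA eps_phi. Qed.

Definition peirce_map x y (f : khom x y) (m : subsp (peirce x)) :
  subsp (peirce y) := mk_subsp (peirce_act f (val m)).

Lemma peirce_mapB x y : bilinear (@peirce_map x y).
Proof.
split=> [m|f] a u v; apply: val_inj => /=.
  by rewrite phiL; exact: ((lm_actB M).1 (val m)).
exact: ((lm_actB M).2 (phi f)).
Qed.

Lemma peirce_map_id x (m : subsp (peirce x)) : peirce_map (kid x) m = m.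
Proof. exact/val_inj/peirceE. Qed.

Lemma peirce_map_comp x y z (g : khom y z) (f : khom x y) m :
  peirce_map (g \ok f) m = peirce_map g (peirce_map f m).
Proof. by apply: val_inj; rewrite /= phi_comp lm_actA. Qed.

Definition peirceModule : catModule C :=
  CatModule peirce_mapB peirce_map_id peirce_map_comp.

(** Unitality only gives sums of vectors [r n]. Each of these is fixed by a left unit of [r], and
    the vectors fixed by some local unit form a subspace because the local units are directed. *)
Lemma unital_peirce : unital M -> forall m : M, exists x, lm_act (eps x) m = m.
Proof.
move=> MU m.
have ex0 : exists x, lm_act (eps x) (0 : M) = 0.
  by have [x _] := common_unit 0 0; exists x; exact: peirce_set0.
have exP a (u v : M) : (exists x, lm_act (eps x) u = u) ->
    (exists x, lm_act (eps x) v = v) ->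
    exists x, lm_act (eps x) (a *: u + v) = a *: u + v.
  move=> [x xu] [y yv]; have [z [zx _ zy _]] := common_unit (eps x) (eps y).
  by exists z; apply: peirce_setP; rewrite -1?xu -1?yv -lm_actA ?zx ?zy.
apply: (MU m (Subspace (subspace_set := fun m => exists x, lm_act (eps x) m = m)
  ex0 exP)) => _ [r [n ->]].
by have [x [xr _ _ _]] := common_unit r r; exists x; rewrite -lm_actA xr.
Qed.

End Peirce.

Section PeirceHom.
Variables (M M' : leftModule R) (f : moduleHom M M').

Lemma peirce_hom_subproof x (m : subsp (peirce M x)) : peirce M' x (f (val m)).
Proof. by rewrite /= -mh_act peirceE. Qed.

Definition peirce_hom_fun x (m : peirceModule M x) : peirceModule M' x :=
  mk_subsp (peirce_hom_subproof m).

Lemma peirce_hom_linear x : linear (@peirce_hom_fun x).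
Proof. by move=> a u v; apply: val_inj; exact: mh_linear. Qed.

Lemma peirce_hom_natural x y (u : khom x y) (m : peirceModule M x) :
  peirce_hom_fun (cm_map u m) = cm_map u (peirce_hom_fun m).
Proof. by apply: val_inj; exact: mh_act. Qed.

Definition peirce_hom : catModuleHom (peirceModule M) (peirceModule M') :=
  CatModuleHom peirce_hom_linear peirce_hom_natural.

End PeirceHom.

Lemma peirce_hom_id (M : leftModule R) :
  peirce_hom (moduleHom_id M) = catModuleHom_id (peirceModule M).
Proof. by apply: catModuleHom_eq => x m; apply: val_inj. Qed.

Lemma peirce_hom_comp (M N P : leftModule R) (g : moduleHom N P)
    (f : moduleHom M N) :
  peirce_hom (moduleHom_comp g f) =
  catModuleHom_comp (peirce_hom g) (peirce_hom f).
Proof. by apply: catModuleHom_eq => x m; apply: val_inj. Qed.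

Definition peirce_functor :
    functor (unitalModuleCategory R) (catModuleCategory C) :=
  @Functor (unitalModuleCategory R) (catModuleCategory C)
    (fun M => peirceModule M) (fun M N f => peirce_hom f)
    (fun M => peirce_hom_id M) (fun M N P g f => peirce_hom_comp g f).

(* The direct limit of the spaces N x along the maps given by eps y ** eps x,
   realised inside the product as the families that are determined by one of
   their components. *)
Section Coherent.
Variable N : catModule C.

(** The model is the family of the [eps y m], for a vector [m] of an [R]-module fixed by [eps x].
    The index [x] is called a base of [n] below. *)
Definition coherent_at x (n : dprod N) : Prop :=
  forall y, n y = cm_map (psi x y (eps x)) (n x).

Lemma cm_lin x y (f : khom x y) : linear (cm_map (c := N) f).
Proof. exact: ((@cm_mapB _ _ N x y).2 f). Qed.

Lemma coherent_at_lin x a u v :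
  coherent_at x u -> coherent_at x v -> coherent_at x (a *: u + v).
Proof. by move=> xu xv y; rewrite cm_lin -xu -xv. Qed.

(** A base may be replaced by a larger one, since [eps y ** eps z ** eps x = eps y ** eps x]. With
    directedness, finitely many coherent families thus share a base. *)
Lemma coherent_at_mono x z n : eps z ** eps x = eps x ->
  coherent_at x n -> coherent_at z n.
Proof.
move=> zx xn y; rewrite (xn z) -cm_map_comp psi_comp // zx.
exact: xn.
Qed.

Lemma coherent_at_common u v :
  (exists x, coherent_at x u) -> (exists x, coherent_at x v) ->
  exists x, coherent_at x u /\ coherent_at x v.
Proof.
move=> [x xu] [y yv]; have [z [zx _ zy _]] := common_unit (eps x) (eps y).
by exists z; split; [exact: coherent_at_mono xu|exact: coherent_at_mono yv].
Qed.

Lemma coherent_set0 : exists x, coherent_at x 0.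
Proof.
by have [x _] := common_unit 0 0; exists x => y; rewrite (lin0 (cm_lin _)).
Qed.

Lemma coherent_setP a u v : (exists x, coherent_at x u) ->
  (exists x, coherent_at x v) -> exists x, coherent_at x (a *: u + v).
Proof.
move=> cu cv; have [x [xu xv]] := coherent_at_common cu cv.
by exists x; exact: coherent_at_lin.
Qed.

Definition coherent : subspace (dprod N) := Subspace coherent_set0 coherent_setP.

Lemma coherent_at_psi x r (m : N x) :
  exists z, coherent_at z (fun y => cm_map (psi x y r) m).
Proof.
have [z [zr _ _ _]] := common_unit r r; exists z => y.
by rewrite -cm_map_comp psi_comp ?zr.
Qed.

(** Both sides are compared with the same expression at a base [w] above [x] and [z]. This makes the
    action of [r] well defined. *)
Lemma coherent_psi_indep x z y n r : coherent_at x n -> coherent_at z n ->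
  cm_map (psi x y r) (n x) = cm_map (psi z y r) (n z).
Proof.
have le t w : eps w ** eps t = eps t -> coherent_at t n ->
    cm_map (psi t y r) (n t) = cm_map (psi w y r) (n w).
  move=> wt tn; rewrite (tn w) -cm_map_comp psi_comp //; congr cm_map.
  by apply: phi_inj; rewrite !psiK -!numulA eps_idem.
move=> xn zn; have [w [wx _ wz _]] := common_unit (eps x) (eps z).
by rewrite (le x w) // (le z w).
Qed.

Lemma coherentP (n : subsp coherent) : exists x, coherent_at x (val n).
Proof. exact: subspP n. Qed.

Definition coherent_base (n : subsp coherent) : C := sval (boolp.cid (coherentP n)).

Lemma coherent_baseP n : coherent_at (coherent_base n) (val n).
Proof. exact: (svalP (boolp.cid (coherentP n))). Qed.

(** The formula is evaluated at an arbitrarily chosen base of [n]. The result has as base any index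
    whose idempotent is a left unit of [r]. *)
Definition coherent_act (r : R) (n : subsp coherent) : subsp coherent :=
  mk_subsp (U := coherent) (coherent_at_psi r (val n (coherent_base n))).

Lemma coherent_actE r n x y : coherent_at x (val n) ->
  val (coherent_act r n) y = cm_map (psi x y r) (val n x).
Proof. by move=> xn; apply: coherent_psi_indep xn; exact: coherent_baseP. Qed.

(** Here [x] need not be a base of [n]: with [z] a base, [n x] is the image of [n z] under
    [eps x ** eps z], and [r ** eps x ** eps z = r ** eps z]. So the component at [x] is enough to
    compute [r n]. *)
Lemma coherent_actEr r n x y : r ** eps x = r ->
  val (coherent_act r n) y = cm_map (psi x y r) (val n x).
Proof.
move=> rx; have xn := coherent_baseP n; set z := coherent_base n in xn.
rewrite (coherent_actE _ _ xn) (xn x) -cm_map_comp psi_compr //.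
by congr cm_map; apply: phi_inj; rewrite !psiK -!numulA eps_idem.
Qed.

Lemma coherent_actB : bilinear coherent_act.
Proof.
split=> [n|r] a u v; apply: val_inj; apply: dprod_ext => y.
  have xn := coherent_baseP n.
  rewrite [RHS]/= !(coherent_actE _ _ xn) psiL.
  exact: ((@cm_mapB _ _ N _ _).1 _).
have [x [xu xv]] := coherent_at_common (coherentP u) (coherentP v).
have xuv : coherent_at x (val (a *: u + v)) by exact: coherent_at_lin.
rewrite (coherent_actE _ _ xuv) [RHS]/=.
have -> : val (a *: u + v) x = a *: val u x + val v x by [].
by rewrite cm_lin -(coherent_actE _ _ xu) -(coherent_actE _ _ xv).
Qed.

Lemma coherent_actA r s n :
  coherent_act (r ** s) n = coherent_act r (coherent_act s n).
Proof.
(* The index [x] sits between the two factors: [rx] allows [r (s n)] to be read off from [s n] at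
   [x], and [xs] makes the two compressions compose to that of [r ** s]. *)
have [x [xs _ _ rx]] := common_unit s r; have zn := coherent_baseP n.
apply: val_inj; apply: dprod_ext => y.
by rewrite (coherent_actEr _ _ rx) !(coherent_actE _ _ zn) -cm_map_comp psi_comp.
Qed.

Definition coherentModule : leftModule R := LeftModule coherent_actB coherent_actA.

Lemma coherent_at_eps x (n : subsp coherent) :
  coherent_at x (val n) -> coherent_act (eps x) n = n.
Proof.
move=> xn; apply: val_inj; apply: dprod_ext => y.
by rewrite (coherent_actE _ _ xn) -xn.
Qed.

Lemma coherent_unital : unital coherentModule.
Proof.
move=> n; apply: sub_lspan; exists (eps (coherent_base n)), n.
by rewrite /= coherent_at_eps //; exact: coherent_baseP.
Qed.

Definition coherentUnitalModule : unitalModule R := UnitalModule coherent_unital.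

End Coherent.

Section CoherentHom.
Variables (N N' : catModule C) (f : catModuleHom N N').

Lemma coherent_at_hom x (n : dprod N) :
  coherent_at x n -> coherent_at x (fun y => f y (n y) : N' y).
Proof. by move=> xn y; rewrite xn cmh_natural. Qed.

Lemma coherent_hom_subproof (n : subsp (coherent N)) :
  coherent N' (fun y => f y (val n y)).
Proof.
exists (coherent_base n); exact/coherent_at_hom/coherent_baseP.
Qed.

Definition coherent_hom_fun (n : coherentModule N) : coherentModule N' :=
  mk_subsp (coherent_hom_subproof n).

Lemma coherent_hom_linear : linear coherent_hom_fun.
Proof.
by move=> a u v; apply: val_inj; apply: dprod_ext => y; exact: cmh_linear.
Qed.

Lemma coherent_hom_act r (n : coherentModule N) :
  coherent_hom_fun (lm_act r n) = lm_act r (coherent_hom_fun n).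
Proof.
have xn := coherent_baseP n; apply: val_inj; apply: dprod_ext => y.
rewrite [RHS](coherent_actE (n := coherent_hom_fun n) _ _ (coherent_at_hom xn)).
by rewrite /= [X in f y X](coherent_actE r y xn) cmh_natural.
Qed.

Definition coherent_hom : moduleHom (coherentModule N) (coherentModule N') :=
  ModuleHom coherent_hom_linear coherent_hom_act.

End CoherentHom.

Lemma coherent_hom_id (N : catModule C) :
  coherent_hom (catModuleHom_id N) = moduleHom_id (coherentModule N).
Proof. by apply: moduleHom_eq => n; apply: val_inj. Qed.

Lemma coherent_hom_comp (N P Q : catModule C) (g : catModuleHom P Q)
    (f : catModuleHom N P) :
  coherent_hom (catModuleHom_comp g f) =
  moduleHom_comp (coherent_hom g) (coherent_hom f).
Proof. by apply: moduleHom_eq => n; apply: val_inj. Qed.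

Definition coherent_functor :
    functor (catModuleCategory C) (unitalModuleCategory R) :=
  @Functor (catModuleCategory C) (unitalModuleCategory R)
    coherentUnitalModule (fun M N f => coherent_hom f)
    (fun M => coherent_hom_id M) (fun M N P g f => coherent_hom_comp g f).

(** * The unit and the counit of the equivalence *)

Section Unit.
Variable M : unitalModule R.

Lemma components_peirce (m : M) x : peirce M x (lm_act (eps x) m).
Proof. exact: peirce_act. Qed.

Definition components (m : M) : dprod (peirceModule M) :=
  fun x => mk_subsp (components_peirce m x).

Lemma components_coherent_at m x :
  lm_act (eps x) m = m -> coherent_at x (components m).
Proof.
move=> xm y; apply: val_inj => /=.
by rewrite psiK -!lm_actA -!numulA !eps_idem !lm_actA xm.
Qed.

(** Unitality of [M] enters here: a local unit fixing [m] supplies a base. *)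
Lemma components_coherent m : coherent (peirceModule M) (components m).
Proof.
have [x xm] := unital_peirce (@um_unital _ _ M) m.
by exists x; exact: components_coherent_at.
Qed.

Definition unit_fun (m : M) : coherentModule (peirceModule M) :=
  mk_subsp (components_coherent m).

Lemma unit_linear : linear unit_fun.
Proof.
move=> a u v; apply: val_inj; apply: dprod_ext => x; apply: val_inj.
exact: ((lm_actB M).2 (eps x)).
Qed.

Lemma unit_act r m : unit_fun (lm_act r m) = lm_act r (unit_fun m).
Proof.
have [x xm] := unital_peirce (@um_unital _ _ M) m.
apply: val_inj; apply: dprod_ext => y; apply: val_inj.
rewrite (coherent_actE (n := unit_fun m) r y (components_coherent_at xm)) /=.
by rewrite psiK !lm_actA !xm.
Qed.

Definition unit_hom : moduleHom M (coherentModule (peirceModule M)) :=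
  ModuleHom unit_linear unit_act.

(** The difference of two vectors with equal components is killed by every [eps x], yet fixed by one
    of them. *)
Lemma unit_inj : injective unit_hom.
Proof.
move=> m m' /(congr1 val) /= mm'.
have xmm' x : lm_act (eps x) m = lm_act (eps x) m'.
  by have /(congr1 (fun f : dprod (peirceModule M) => val (f x))) := mm'.
have mm'0 : m - m' = 0.
  have [x <-] := unital_peirce (@um_unital _ _ M) (m - m').
  rewrite -scaleN1r (linD ((lm_actB M).2 _)) (linZ ((lm_actB M).2 _)) xmm'.
  by rewrite scaleN1r subrr.
by apply/eqP; rewrite -subr_eq0 mm'0.
Qed.

Lemma unit_surj n : exists m, unit_hom m = n.
Proof.
have xn := coherent_baseP n; set x := coherent_base n in xn.
(* The preimage is the component of [n] at a base, seen as a vector of [M]. *)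
exists (val (val n x)); apply: val_inj; apply: dprod_ext => y; apply: val_inj.
by rewrite (xn y) /= psiK !lm_actA !peirceE.
Qed.

End Unit.

Section Counit.
Variable N : catModule C.

Definition eval_fun x (n : peirceModule (coherentModule N) x) : N x :=
  val (val n) x.

Lemma eval_linear x : linear (@eval_fun x).
Proof. by []. Qed.

Lemma eval_natural x y (f : khom x y) n :
  eval_fun (cm_map f n) = cm_map f (eval_fun n).
(* As [phi f] absorbs [eps x] on the right, its action only involves the component at [x], where it
   is [psi x y (phi f) = f]. *)
Proof. by have := coherent_actEr (val n) y (phi_eps f); rewrite phiK. Qed.

Definition eval_hom : catModuleHom (peirceModule (coherentModule N)) N :=
  CatModuleHom eval_linear eval_natural.

(** A family fixed by [eps x] equals its image under [eps x], which [coherent_actEr] recovers from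
    the component at [x] alone. *)
Lemma eval_inj x : injective (@eval_fun x).
Proof.
move=> m n mn; apply: val_inj; apply: val_inj; apply: dprod_ext => y.
rewrite -(peirceE m) -(peirceE n).
rewrite [LHS](coherent_actEr (val m) y (eps_idem x)).
rewrite [RHS](coherent_actEr (val n) y (eps_idem x)).
exact: congr1 mn.
Qed.

Lemma eval_surj x (n : N x) : exists m, eval_fun m = n.
Proof.
(* The family generated by [n], with component at [y] the image of [n] under [eps y ** eps x]; its
   component at [x] is [n], so [x] is a base and [eps x] fixes it. *)
pose m : coherentModule N := mk_subsp (U := coherent N) (coherent_at_psi (eps x) n).
have mE : val m x = n by rewrite /= phiK cm_map_id.
have xm : coherent_at x (val m) by move=> y; rewrite mE.
exists (mk_subsp (U := peirce (coherentModule N) x) (coherent_at_eps xm)).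
exact: mE.
Qed.

End Counit.

Theorem corner_equivalence :
  equivalent (unitalModuleCategory R) (catModuleCategory C).
Proof.
exists peirce_functor, coherent_functor; split.
  apply: natural_iso_sym; exists (fun M => unit_hom M); split=> [M M' f|M].
    apply: moduleHom_eq => m; apply: val_inj; apply: dprod_ext => x.
    by apply: val_inj; rewrite /= mh_act.
  by apply: moduleHom_iso; [exact: unit_inj|exact: unit_surj].
exists eval_hom; split=> [N N' f|N].
  by apply: catModuleHom_eq => x n.
by apply: catModuleHom_iso; [exact: eval_inj|exact: eval_surj].
Qed.

End CornerEquivalence.

(** * The smash category as the category of corners of the partial smash product *)

Section SmashCorners.
Variables (k : fieldType) (H : hopfAlgebra k) (A : nuAlgebra k).
Variables (act : partialAction H A) (Lam : Type) (e : Lam -> A).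
Hypotheses (eS : localUnits e) (eC : categorizable act e).
Local Notation C := (smash_category (corner_action eS eC)).
Local Notation hom := (corner_hom e).
Local Notation embed := (tlift (fun f h => val f *t h)).

Lemma embedB i j : bilinear (fun (f : hom i j) (h : H) => val f *t h).
Proof.
split=> [h|f] a u v; first exact: ((tensB _ _).1 h).
exact: ((tensB _ _).2 (val f)).
Qed.

Lemma embedL i j : linear (fun t : hom i j *t H => embed t).
Proof. exact: (tlift_lin (@embedB i j)). Qed.

Lemma embedE i j (f : hom i j) (h : H) : embed (f *t h) = val f *t h.
Proof. by rewrite tliftE //; exact: embedB. Qed.

(** The compression of [a] to [e j ** a ** e i]. *)
Definition corner_proj i j (a : A) : hom i j :=
  mk_subsp (U := corner (e j) (e i)) (ex_intro _ a erefl).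

Local Notation restrict i j := (tlift (fun a h => corner_proj i j a *t h)).

Lemma corner_projL i j : linear (corner_proj i j).
Proof.
move=> c a b; apply: val_inj => /=.
by rewrite ((numulB A).2 (e j)) ((numulB A).1 (e i)).
Qed.

Lemma restrictB i j : bilinear (fun a (h : H) => corner_proj i j a *t h).
Proof.
split=> [h|a]; first exact: (bilin_l _ (tensB _ _) (@corner_projL i j)).
exact: ((tensB _ _).2 _).
Qed.

Lemma restrictE i j a (h : H) : restrict i j (a *t h) = corner_proj i j a *t h.
Proof. by rewrite tliftE //; exact: restrictB. Qed.

(** The map of tensor products induced by the inclusion of a corner in [A] is injective because
    compression to the corner induces an explicit retraction. *)
Lemma embedK i j (t : hom i j *t H) : restrict i j (embed t) = t.
Proof.
move: t; apply: tensP => [||f h].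
- exact: lin_comp (tlift_lin (@restrictB i j)) (@embedL i j).
- exact: lin_id.
rewrite embedE restrictE; congr (_ *t _); apply: val_inj => /=.
by rewrite (corner_l eS (subspP f)) (corner_r eS (subspP f)).
Qed.

Lemma smash_tensE a b (h l : H) : (a *t h : fullSmash act) ** (b *t l) =
  \sw_(h1, h2 <- h) ((a ** act h1 b) *t (h2 * l)).
Proof. exact: (smash_mulE (numulB A) (pactB act)). Qed.

Lemma embed_comp i j l (t : hom j l *t H) (s : hom i j *t H) :
  embed (full_smash_comp (corner_action eS eC) t s) =
  (embed t : fullSmash act) ** embed s.
Proof.
have cB := full_smash_compB (corner_action eS eC) i j l.
have sB := numulB (fullSmash act).
move: t; apply: tensP => [||g h].
- exact: lin_comp (@embedL i l) (cB.1 s).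
- exact: bilin_l sB (@embedL j l).
move: s; apply: tensP => [||f h'].
- exact: lin_comp (@embedL i l) (cB.2 _).
- exact: bilin_r sB (@embedL i j).
rewrite !embedE smash_tensE /full_smash_comp smash_mulE.
- rewrite (tlift_comp _ _ (@embedL i l)); apply: eq_tlift => h1 h2.
  by rewrite embedE.
- exact: (@kcompB _ (corner_category eS)).
- exact: (@cactB _ _ _ (corner_action eS eC)).
Qed.

Lemma embed_partial i j (t : hom i j *t H) :
  smash_hom (corner_action eS eC) i j t -> partial_smash_space act (embed t).
Proof.
move: t; apply: lspan_image; first exact: (@embedL i j).
move=> _ [f [h ->]]; apply: sub_lspan; exists (val f), (e i), h.
rewrite (tlift_comp _ _ (@embedL i j)); apply: eq_tlift => h1 h2.
by rewrite embedE.
Qed.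

Definition smash_embed (i j : C) (t : khom i j) : partialSmash act :=
  mk_subsp (embed_partial (subspP t)).

Lemma smash_embedL i j : linear (@smash_embed i j).
Proof. by move=> a u v; apply: val_inj; exact: (@embedL i j). Qed.

Lemma smash_embed_inj i j : injective (@smash_embed i j).
Proof.
move=> s t /(congr1 val) /= st; apply: val_inj.
by rewrite -[LHS]embedK st embedK.
Qed.

Lemma smash_embed_comp i j l (t : @khom k C j l) (s : @khom k C i j) :
  smash_embed (t \ok s) = smash_embed t ** smash_embed s.
Proof. by apply: val_inj; exact: embed_comp. Qed.

(* b ** e i lies in e l A e i as soon as e l ** b = b, so this is the stability
   of the corners under the action. *)
Lemma act_mul_idem i b h : act h (b ** e i) ** e i = act h (b ** e i).
Proof.
have [l lP] := lu_unit eS [:: b].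
have [lb _] : e l ** b = b /\ b ** e l = b by apply: lP; rewrite inE eqxx.
apply: (corner_r eS (j := l)); apply: (pact_corner eS eC); apply: cornerI.
  by rewrite numulA lb.
by rewrite -numulA (lu_idem eS).
Qed.

Lemma smash_idem_l i a (h : H) : (e i *t 1 : fullSmash act) ** (a *t h) =
  (e i ** a) *t h.
Proof.
rewrite smash_tensE sw1 ?pact1 ?mul1r //.
exact: (smash_coreB_h (numulB A) (pactB act)).
Qed.

(** Cutting the generator [(a # h)(b # 1)] gives the sum of the
    [e j ** a ** act h1 (b ** e i) # h2]. By [act_mul_idem], hence by categorizability, the first
    factors already lie in the corner, so compressing them changes nothing. *)
Lemma restrictK i j (x : fullSmash act) : partial_smash_space act x ->
  let y := (e j *t 1 : fullSmash act) ** x ** (e i *t 1 : fullSmash act) in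
  embed (restrict i j y) = y.
Proof.
have sB := numulB (fullSmash act).
have cutL : linear (fun x : fullSmash act =>
    (e j *t 1 : fullSmash act) ** x ** (e i *t 1 : fullSmash act)).
  exact: bilin_l sB (sB.2 _).
have erL := lin_comp (@embedL i j) (tlift_lin (@restrictB i j)).
move: x; apply: (lspan_ext (lin_comp erL cutL) cutL) => _ [a [b [h ->]]].
rewrite partial_smash_gen [_ ** (_ ** _)]numulA smash_idem_l -numulA.
have -> : (b *t 1 : fullSmash act) ** (e i *t 1) = (b ** e i) *t 1.
  rewrite smash_tensE sw1 ?pact1 ?mulr1 //.
  exact: (smash_coreB_h (numulB A) (pactB act)).
rewrite smash_tensE (tlift_comp _ _ erL); apply: eq_tlift => h1 h2.
rewrite restrictE embedE /= -!numulA act_mul_idem.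
by rewrite [e j ** (e j ** _)]numulA (lu_idem eS).
Qed.

Lemma restrict_partial i j (x : fullSmash act) : partial_smash_space act x ->
  smash_hom (corner_action eS eC) i j (restrict i j
    ((e j *t 1 : fullSmash act) ** x ** (e i *t 1 : fullSmash act))).
Proof.
move=> xP; set y := _ ** _; set t := restrict i j y.
(* Composing with the identity of [i] always lands in the morphism space, so it is enough that this
   composition fixes [t]; this is checked after embedding into [A # H]. *)
suff <- : full_smash_comp (corner_action eS eC) t (corner_id eS i *t 1) = t.
  exact: (smash_hom_id_r (act := corner_action eS eC)).
rewrite -[LHS]embedK embed_comp -[RHS]embedK; congr (restrict i j _).
rewrite embedE (restrictK _ _ xP) -numulA smash_idem_l.
by rewrite [val _](_ : _ = e i) // (lu_idem eS).
Qed.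

Definition smash_restrict (i j : C) (x : partialSmash act) : khom i j :=
  mk_subsp (restrict_partial (i := i) (j := j) (subspP x)).

Lemma smash_restrictK i j x : smash_embed (smash_restrict i j x) =
  smash_embed (@kid k C j) ** x ** smash_embed (@kid k C i).
Proof.
apply: val_inj; rewrite [LHS]restrictK; last exact: subspP.
by rewrite /= !embedE.
Qed.

(** A generator [(a # h)(b # 1)] is fixed on both sides by [e i # 1] once [e i] is a unit for [a]
    and [b]. Finitely many elements of the smash product thus involve only finitely many elements of
    [A]. *)
Lemma smash_embed_units : localUnits (fun i => smash_embed (@kid k C i)).
Proof.
split=> [i|F]; first by rewrite -smash_embed_comp kid_l.
pose unit i (x : fullSmash act) := (e i *t 1 : fullSmash act) ** x = x /\
  x ** (e i *t 1 : fullSmash act) = x.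
(* Recording a finite list in [A] instead of an index turns closure under sums into concatenation of
   lists; the index is chosen once, at the end. *)
pose unital_on x := exists s : seq A, forall i,
  {in s, forall a, e i ** a = a /\ a ** e i = a} -> unit i x.
have sB := numulB (fullSmash act).
have U0 : unital_on 0.
  by exists [::] => i _; split; [rewrite (lin0 (sB.2 _))|rewrite (lin0 (sB.1 _))].
have UP c x y : unital_on x -> unital_on y -> unital_on (c *: x + y).
  move=> [s sx] [t ty]; exists (s ++ t) => i iP.
  have [ix xi] : unit i x by apply: sx => a sa; apply: iP; rewrite mem_cat sa.
  have [iy yi] : unit i y.
    by apply: ty => a ta; apply: iP; rewrite mem_cat ta orbT.
  split; first by rewrite (sB.2 _) ix iy.
  by rewrite (sB.1 _) xi yi.
have UR x : partial_smash_space act x -> unital_on x.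
  move/(_ (Subspace U0 UP)); apply=> _ [a [b [h ->]]]; exists [:: a; b] => i iP.
  have [ia _] : e i ** a = a /\ a ** e i = a by apply: iP; rewrite !inE eqxx.
  have [_ bi] : e i ** b = b /\ b ** e i = b.
    by apply: iP; rewrite !inE eqxx orbT.
  rewrite partial_smash_gen; split; first by rewrite numulA smash_idem_l ia.
  rewrite -numulA [X in _ ** X]smash_tensE sw1 ?pact1 ?mulr1 ?bi //.
  exact: (smash_coreB_h (numulB A) (pactB act)).
have [s sP] : exists s : seq A, forall i,
    {in s, forall a, e i ** a = a /\ a ** e i = a} ->
    {in F, forall x, unit i (val x)}.
  elim: F => [|x F [s sF]]; first by exists [::].
  have [t tx] := UR _ (subspP x); exists (t ++ s) => i iP y.
  rewrite inE => /predU1P [->|yF].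
    by apply: tx => a ta; apply: iP; rewrite mem_cat ta.
  by apply: sF => // a sa; apply: iP; rewrite mem_cat sa orbT.
have [i iP] := lu_unit eS s; exists i => x xF.
have [ix xi] := sP i iP x xF.
by split; apply: val_inj; rewrite [LHS]/= embedE.
Qed.

End SmashCorners.

Theorem corollary85 (k : fieldType) (H : hopfAlgebra k) (A : nuAlgebra k)
    (act : partialAction H A) (Lam : Type) (e : Lam -> A)
    (eS : localUnits e) (act_sym : symmetrical act)
    (eC : categorizable act e) :
  equivalent (unitalModuleCategory (partialSmash act))
             (catModuleCategory (smash_category (corner_action eS eC))).
Proof.
exact: corner_equivalence (@smash_embedL _ _ _ _ _ _ eS eC)
  (@smash_embed_inj _ _ _ _ _ _ eS eC) (@smash_embed_comp _ _ _ _ _ _ eS eC)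
  (@smash_restrictK _ _ _ _ _ _ eS eC) (smash_embed_units eS eC).
Qed.
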